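(* Let $r$ be continuous, let $f$ be a nontrivial real solution of $f''(x)+r(x)f(x)=0$, let $z_{f'_1}<z_{f'_2}$ be two consecutive zeros of $f'$, let $\mathcal{I}=(z_{f'_1},z_{f'_2})$, and let $z_{f_1}$ be the unique zero of $f$ in $\mathcal{I}$. Put $h=f/f'$ on $\mathcal I$. Suppose $r$ is positive and non-decreasing in $\mathcal{I}$. Let $x_0,y_0\in\mathcal I$ with $x_0<z_{f_1}<y_0$, and let $(x_n)$, $(y_n)$ be the sequences generated by $$x_{n+1}=x_n-\frac{2h(x_n)}{2+r(y_0)h^2(x_n)},\qquad y_{n+1}=y_n-\frac{2h(y_n)}{2+r(y_0)h^2(y_n)},\qquad n=0,1,2,\dots$$ (the constant $r(y_0)$ is used in both recursions). Then $(x_n)$ and $(y_n)$ converge monotonically to $z_{f_1}$ and, for every $n$, $$x_0<x_1<x_2<\cdots<x_n<z_{f_1}<y_n<\cdots<y_2<y_1<y_0.$$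
   Context: All functions are real-valued; $r$ is continuous on an open interval $D\subseteq\mathbb{R}$ containing all points mentioned, and $f$ is a not identically zero solution on $D$ of $f''+rf=0$. It is a standing assumption that $f$ has exactly one zero $z_{f_1}$ in $\mathcal I=(z_{f'_1},z_{f'_2})$. Since $f'$ has no zeros in $\mathcal I$, the function $h=f/f'$ is defined on $\mathcal I$. ''Converges monotonically'' means that the sequence is monotone and converges. *)

(* Defs.v *)
From Stdlib Require Import Reals.
From Coquelicot Require Import Coquelicot.
Open Scope R_scope.

(* Open intervals ]a, b[ with possibly infinite endpoints; finite endpoints
   enter through the coercion from R to Rbar. *)
Definition in_oo (a b : Rbar) (x : R) : Prop := Rbar_lt a x /\ Rbar_lt x b.

(* Coquelicot's Derive is total, so differentiability of f and f' is required
   explicitly. *)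
Definition is_solution (a b : Rbar) (r f : R -> R) : Prop :=
  forall x : R, in_oo a b x ->
    ex_derive f x /\ ex_derive (Derive f) x /\
    Derive (Derive f) x + r x * f x = 0.

Definition consecutive_zeros (g : R -> R) (z1 z2 : R) : Prop :=
  z1 < z2 /\ g z1 = 0 /\ g z2 = 0 /\ forall x : R, in_oo z1 z2 x -> g x <> 0.

Definition unique_zero_in (g : R -> R) (a b z : R) : Prop :=
  unique (fun x : R => in_oo a b x /\ g x = 0) z.

(* Meaningful only where Derive f x <> 0; division is total. *)
Definition h (f : R -> R) (x : R) : R := f x / Derive f x.

Definition step (f : R -> R) (c x : R) : R :=
  x - 2 * h f x / (2 + c * h f x ^ 2).

Definition generated_by (g : R -> R) (u0 : R) (u : nat -> R) : Prop :=
  u 0%nat = u0 /\ forall n : nat, u (S n) = g (u n).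

Definition converges_monotonically (u : nat -> R) (l : R) : Prop :=
  (Un_growing u \/ Un_decreasing u) /\ is_lim_seq u l.

(* Main.v *)
(* By the Riccati equation h' = 1 + r h^2, the step map g(t) = t - 2h/(2 + c h^2)
   with c = r(y0) has derivative 1 - (1 + r h^2)(4 - 2c h^2)/(2 + c h^2)^2.  Since
   0 < r <= c on (z1, y0], this is positive there except at the fixed point zf
   (the only zero of h), so by the mean value theorem g keeps each point on its
   side of zf; as the sign of g(t) - t is that of -h(t), g moves points towards
   zf.  The limit of a monotone orbit is then a fixed point of g, hence zf. *)
Require Import Defs.
From Stdlib Require Import Reals Lra.
From Coquelicot Require Import Coquelicot.
Open Scope R_scope.

Lemma increasing_orbit_bounds (g : R -> R) (u0 l : R) (u : nat -> R)
  (u0_lt : u0 < l)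
  (g_up : forall t : R, u0 <= t < l -> t < g t < l)
  (u_gen : generated_by g u0 u) :
  forall n : nat, u0 <= u n < l.
Proof.
destruct u_gen as [u_0 u_S].
induction n as [|n IH].
- rewrite u_0; lra.
- rewrite u_S; specialize (g_up _ IH); lra.
Qed.

(** The orbit is increasing and bounded by [l], so it has a limit [m] in [[u0, l]]. Continuity makes
    [m] a fixed point of [g], and [g_up] rules out fixed points below [l]. *)
Lemma increasing_orbit_lim (g : R -> R) (u0 l : R) (u : nat -> R)
  (u0_lt : u0 < l)
  (g_up : forall t : R, u0 <= t < l -> t < g t < l)
  (g_cont : forall t : R, u0 <= t <= l -> continuous g t)
  (u_gen : generated_by g u0 u) :
  is_lim_seq u l.
Proof.
pose proof (increasing_orbit_bounds g u0 l u u0_lt g_up u_gen) as bounds.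
destruct u_gen as [u_0 u_S].
assert (u_lim : ex_finite_lim_seq u).
{ apply ex_finite_lim_seq_incr with l; intro n.
  - rewrite u_S; apply Rlt_le, g_up, bounds.
  - apply Rlt_le, bounds. }
destruct u_lim as [m u_lim].
assert (u0_m : u0 <= m).
{ apply (is_lim_seq_le (fun _ => u0) u u0 m); trivial.
  - intro n; apply bounds.
  - apply is_lim_seq_const. }
assert (m_l : m <= l).
{ apply (is_lim_seq_le u (fun _ => l) m l); trivial.
  - intro n; apply Rlt_le, bounds.
  - apply is_lim_seq_const. }
assert (m_fix : g m = m).
{ assert (lim1 : is_lim_seq (fun n => u (S n)) (g m)).
  { apply is_lim_seq_ext with (fun n => g (u n)).
    - intro n; symmetry; apply u_S.
    - apply is_lim_seq_continuous; trivial.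
      apply continuity_pt_filterlim, g_cont; lra. }
  apply is_lim_seq_incr_1 in u_lim.
  apply is_lim_seq_unique in lim1; apply is_lim_seq_unique in u_lim.
  congruence. }
destruct (Req_dec m l) as [<-|m_ne]; trivial.
assert (m < g m < l) by (apply g_up; lra).
lra.
Qed.

(** Quotient rule with [f'' = - q f]; [q] stands for the value of [r] at [t], since the Riccati
    equation is needed only pointwise. *)
Lemma is_derive_h (f : R -> R) (t q : R) :
  ex_derive f t -> ex_derive (Derive f) t ->
  Derive (Derive f) t + q * f t = 0 -> Derive f t <> 0 ->
  is_derive (h f) t (1 + q * h f t ^ 2).
Proof.
intros f_der f'_der ode f'_ne.
unfold h.
replace (1 + q * (f t / Derive f t) ^ 2)
  with ((Derive f t * Derive f t - f t * Derive (Derive f) t) / Derive f t ^ 2).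
- apply is_derive_div; trivial; apply Derive_correct; trivial.
- replace (Derive (Derive f) t) with (- (q * f t)) by lra.
  field; trivial.
Qed.

Lemma is_derive_step (f : R -> R) (c t d : R) :
  0 < c -> is_derive (h f) t d ->
  is_derive (step f c) t
    (1 - d * (4 - 2 * (c * h f t ^ 2)) / (2 + c * h f t ^ 2) ^ 2).
Proof.
intros c_pos h_der.
pose proof (pow2_ge_0 (h f t)) as sq.
assert (den : 2 + c * h f t ^ 2 <> 0) by nra.
assert (ex : ex_derive (h f) t) by (exists d; trivial).
pose proof (is_derive_unique _ _ _ h_der) as h'.
unfold step.
auto_derive.
- repeat split; trivial.
- change (Derive (fun x => h f x) t) with (Derive (h f) t).
  rewrite h'; field; trivial.
Qed.

Lemma step_slope_pos (c q k : R) :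
  0 < q -> q <= c -> k <> 0 ->
  0 < 1 - (1 + q * k ^ 2) * (4 - 2 * (c * k ^ 2)) / (2 + c * k ^ 2) ^ 2.
Proof.
intros q_pos q_le k_ne.
assert (k2 : 0 < k ^ 2) by (apply pow2_gt_0; trivial).
set (v := q * k ^ 2); set (w := c * k ^ 2).
assert (v_pos : 0 < v) by (apply Rmult_lt_0_compat; lra).
assert (v_le : v <= w) by (apply Rmult_le_compat_r; lra).
clearbody v w.
replace (1 - (1 + v) * (4 - 2 * w) / (2 + w) ^ 2)
  with (((2 + w) ^ 2 - (1 + v) * (4 - 2 * w)) / (2 + w) ^ 2) by (field; lra).
apply Rdiv_lt_0_compat; [|apply pow_lt; lra].
(* If [w <= 2], then [4 - 2 * w] is nonnegative, so [v] may be replaced by [w] and the numerator is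
   at least [2 * w + 3 * w ^ 2]. If [w > 2], the subtracted product is negative. *)
destruct (Rle_dec w 2); nra.
Qed.

Theorem theorem3p4
  (a b : Rbar) (r f : R -> R) (z1 z2 zf x0 y0 : R) (x y : nat -> R)
  (r_cont : forall t : R, in_oo a b t -> continuous r t)
  (f_sol : is_solution a b r f)
  (f_nontrivial : exists t : R, in_oo a b t /\ f t <> 0)
  (z1_D : in_oo a b z1)
  (z2_D : in_oo a b z2)
  (z12 : consecutive_zeros (Derive f) z1 z2)
  (zf_zero : unique_zero_in f z1 z2 zf)
  (r_pos : forall t : R, in_oo z1 z2 t -> 0 < r t)
  (r_mono : forall s t : R,
     in_oo z1 z2 s -> in_oo z1 z2 t -> s <= t -> r s <= r t)
  (x0_I : in_oo z1 z2 x0)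
  (y0_I : in_oo z1 z2 y0)
  (x0_lt : x0 < zf)
  (lt_y0 : zf < y0)
  (x_gen : generated_by (step f (r y0)) x0 x)
  (y_gen : generated_by (step f (r y0)) y0 y) :
  converges_monotonically x zf /\
  converges_monotonically y zf /\
  (forall n : nat,
     (forall k : nat, (k < n)%nat -> x k < x (S k)) /\
     x n < zf /\ zf < y n /\
     (forall k : nat, (k < n)%nat -> y (S k) < y k)).
Proof.
destruct z12 as (_ & _ & _ & f'_ne).
destruct zf_zero as [[zf_I f_zf] zf_uniq].
simpl in f'_ne, zf_I, zf_uniq, r_pos, r_mono, x0_I, y0_I.
unfold in_oo in *; simpl in *.
set (c := r y0) in *.
assert (c_pos : 0 < c) by (apply r_pos; lra).
assert (I_D : forall t, z1 < t < z2 -> Rbar_lt a t /\ Rbar_lt t b).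
{ intros t t_I; split.
  - apply Rbar_lt_trans with z1; [tauto|simpl; lra].
  - apply Rbar_lt_trans with z2; [simpl; lra|tauto]. }
assert (h_der : forall t, z1 < t < z2 ->
  is_derive (h f) t (1 + r t * h f t ^ 2)).
{ intros t t_I.
  destruct (f_sol t (I_D t t_I)) as (f_der & f'_der & ode).
  apply is_derive_h; auto. }
assert (h_zf : h f zf = 0) by (unfold h; rewrite f_zf; apply Rdiv_0_l).
assert (h_ne : forall t, z1 < t < z2 -> t <> zf -> h f t <> 0).
{ intros t t_I t_ne h_0; apply t_ne; symmetry; apply zf_uniq; split; trivial.
  replace (f t) with (h f t * Derive f t).
  - rewrite h_0; ring.
  - unfold h; field; auto. }
(* The derivative of [h f] is at least 1; with [h_zf] this fixes the sign of [h f] on each side of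
   [zf]. *)
assert (h_incr : forall s t, z1 < s -> s < t -> t < z2 -> h f s < h f t).
{ intros s t s_I st t_I.
  destruct (MVT_cor2 (h f) (fun e => 1 + r e * h f e ^ 2) s t st)
    as (e & e_eq & e_I).
  { intros e e_I; apply is_derive_Reals, h_der; lra. }
  assert (0 < r e) by (apply r_pos; lra).
  pose proof (pow2_ge_0 (h f e)).
  assert (0 < 1 + r e * h f e ^ 2) by nra.
  nra. }
set (g := step f c) in *.
assert (g_der : forall t, z1 < t < z2 -> is_derive g t
  (1 - (1 + r t * h f t ^ 2) * (4 - 2 * (c * h f t ^ 2))
       / (2 + c * h f t ^ 2) ^ 2)).
{ intros t t_I; apply is_derive_step; auto. }
assert (g_cont : forall t, z1 < t < z2 -> continuous g t).
{ intros t t_I; apply (ex_derive_continuous (V := R_NormedModule)).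
  eexists; apply g_der, t_I. }
assert (g_zf : g zf = zf) by (unfold g, step; rewrite h_zf; field; lra).
(* The bound [e <= y0] turns monotonicity of [r] into [r e <= c]. As [zf < y0], it also covers every
   point to the left of [zf], so one constant serves both orbits. *)
assert (slope_pos : forall e, z1 < e <= y0 -> e <> zf ->
  0 < 1 - (1 + r e * h f e ^ 2) * (4 - 2 * (c * h f e ^ 2))
          / (2 + c * h f e ^ 2) ^ 2).
{ intros e e_I e_ne; apply step_slope_pos.
  - apply r_pos; lra.
  - apply r_mono; lra.
  - apply h_ne; lra. }
(* The displacement is [- h f t] times a positive factor, so its direction depends only on the sign
   of [h f t]. *)
assert (step_eq : forall t,
  g t - t = - h f t * (2 / (2 + c * h f t ^ 2)) /\
  0 < 2 / (2 + c * h f t ^ 2)).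
{ intro t; pose proof (pow2_ge_0 (h f t)).
  assert (0 < 2 + c * h f t ^ 2) by nra.
  split; [unfold g, step; field; lra|apply Rdiv_lt_0_compat; lra]. }
assert (g_left : forall t, x0 <= t < zf -> t < g t < zf).
{ intros t t_I; split.
  - destruct (step_eq t) as [eq pos].
    assert (h f t < h f zf) by (apply h_incr; lra).
    nra.
  (* Since [g zf = zf], this reads [zf - g t = g'(e) * (zf - t)], where [g'(e)] is the derivative at
     [e]. The slope vanishes at [zf], but [e] lies strictly between [t] and [zf], so the product is
     positive and [g] cannot overshoot. *)
  - destruct (MVT_cor2 g _ t zf (proj2 t_I)
      (fun e e_I => proj1 (is_derive_Reals _ _ _) (g_der e ltac:(lra))))
      as (e & e_eq & e_I).
    assert (slope := slope_pos e ltac:(lra) ltac:(lra)); nra. }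
assert (g_right : forall t, zf < t <= y0 -> zf < g t < t).
{ intros t t_I; split.
  - destruct (MVT_cor2 g _ zf t (proj1 t_I)
      (fun e e_I => proj1 (is_derive_Reals _ _ _) (g_der e ltac:(lra))))
      as (e & e_eq & e_I).
    assert (slope := slope_pos e ltac:(lra) ltac:(lra)); nra.
  - destruct (step_eq t) as [eq pos].
    assert (h f zf < h f t) by (apply h_incr; lra).
    nra. }
(* The orbit of y0 is decreasing, so it is handled after conjugation by t -> -t. *)
pose (g' t := - g (- t)).
pose (y' n := - y n).
assert (y'_gen : generated_by g' (- y0) y').
{ destruct y_gen as [y_0 y_S]; split; unfold y', g'.
  - now rewrite y_0.
  - intro n; now rewrite y_S, Ropp_involutive. }
assert (g'_up : forall t, - y0 <= t < - zf -> t < g' t < - zf).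
{ intros t t_I; unfold g'.
  assert (zf < g (- t) < - t) by (apply g_right; lra); lra. }
assert (g'_cont : forall t, - y0 <= t <= - zf -> continuous g' t).
{ intros t t_I; apply (continuous_opp (V := R_NormedModule)).
  apply (continuous_comp Ropp g).
  - apply (continuous_opp (V := R_NormedModule)), continuous_id.
  - apply g_cont; lra. }
assert (x_bounds := increasing_orbit_bounds g x0 zf x x0_lt g_left x_gen).
assert (y_bounds : forall n, zf < y n <= y0).
{ intro n; assert (b' := increasing_orbit_bounds g' (- y0) (- zf) y'
    ltac:(lra) g'_up y'_gen n); unfold y' in b'; lra. }
assert (x_lim : is_lim_seq x zf).
{ apply (increasing_orbit_lim g x0); trivial.
  intros t t_I; apply g_cont; lra. }
assert (y_lim : is_lim_seq y zf).
{ apply is_lim_seq_ext with (fun n => - y' n).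
  - intro n; unfold y'; ring.
  - replace (Finite zf) with (Rbar_opp (- zf)) by (simpl; f_equal; ring).
    apply -> is_lim_seq_opp.
    apply (increasing_orbit_lim g' (- y0)); trivial; lra. }
assert (x_incr : forall n, x n < x (S n)).
{ intro n; rewrite (proj2 x_gen); apply g_left, x_bounds. }
assert (y_decr : forall n, y (S n) < y n).
{ intro n; rewrite (proj2 y_gen); apply g_right, y_bounds. }
split; [|split].
- split; trivial; left; intro n; apply Rlt_le, x_incr.
- split; trivial; right; intro n; apply Rlt_le, y_decr.
- intro n; repeat split; auto.
  + apply x_bounds.
  + apply y_bounds.
Qed.
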